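(* Let $Z \subset (\mathbb{C}^{\times})^n$ be a very affine linear space. Then the angle map \[ \mathrm{ang}\colon Z \longrightarrow (S^1)^n,\qquad x=(x_1,\dots,x_n)\longmapsto \left(\frac{x_1}{|x_1|},\dots,\frac{x_n}{|x_n|}\right) \] is a homotopy equivalence from $Z$ onto its image $\Theta := \mathrm{ang}(Z)$ (with the subspace topology of $(S^1)^n$).
   Context: $S^1=\{z\in\mathbb{C}:|z|=1\}$; $(\mathbb{C}^\times)^n$ and $(S^1)^n$ carry the Euclidean topology. A very affine linear space is a nonempty closed subvariety $Z\subset(\mathbb{C}^\times)^n$ whose ideal in $\mathbb{C}[x_1^{\pm1},\dots,x_n^{\pm1}]$ is generated by affine linear polynomials $c_0+c_1x_1+\dots+c_nx_n$ with $c_i\in\mathbb{C}$. Equivalently, $Z$ is the image of the complement $\mathbb{P}^d\setminus\bigcup_{j=0}^n V(H_j)$ of an essential projective hyperplane arrangement under $P\mapsto [H_0(P):\dots:H_n(P)]$, where the torus of $\mathbb{P}^n$ is identified with $(\mathbb{C}^\times)^n$ (essential meaning this map is injective). *)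

(* Defs.v *)
(* The complex numbers are modelled as
   R[i] (mathcomp-real-closed's [complex R]) over an arbitrary realType R,
   equipped (via the regular algebra alias ^o) with its Euclidean normed
   topology; (C^x)^n and (S^1)^n are subsets of row vectors 'rV[C]_n,
   with the (product = max-norm) Euclidean topology. *)
From HB Require Import structures.
From mathcomp Require Import all_boot all_order all_algebra.
From mathcomp Require Import all_classical all_reals all_analysis.
From mathcomp Require Import complex.
Import numFieldNormedType.Exports.

Set Implicit Arguments.
Unset Strict Implicit.
Unset Printing Implicit Defensive.

Import Order.TTheory GRing.Theory Num.Theory.
Local Open Scope classical_set_scope.
Local Open Scope ring_scope.

Definition CC (R : realType) := (R[i])^o.

Definition torus (R : realType) (n : nat) : set 'rV[CC R]_n :=
  [set x | forall j : 'I_n, x ord0 j != 0].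

Definition circle_torus (R : realType) (n : nat) : set 'rV[CC R]_n :=
  [set x | forall j : 'I_n, `|x ord0 j| = 1].

(* A very affine linear space: a nonempty subset Z of (C^x)^n which is the
   zero locus in the torus of finitely many affine linear polynomials
   c_0 + c_1 x_1 + ... + c_n x_n  (row k of A is (c_1..c_n), -b_k is c_0),
   i.e. a closed subvariety whose ideal is generated by affine linear
   polynomials. *)
Definition very_affine_linear (R : realType) (n : nat) (Z : set 'rV[CC R]_n) :=
  Z !=set0 /\
  exists (m : nat) (A : 'M[CC R]_(m, n)) (b : 'cV[CC R]_m),
    Z = [set x | torus x /\ A *m x^T = b].

Definition ang (R : realType) (n : nat) (x : 'rV[CC R]_n) : 'rV[CC R]_n :=
  \row_(j < n) (x ord0 j / `|x ord0 j|).

Definition homotopic_on (R : realType) (X Y : topologicalType)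
    (A : set X) (B : set Y) (f g : X -> Y) : Prop :=
  exists H : (R * X)%type -> Y,
    [/\ {within [set p | 0 <= p.1 <= 1 /\ A p.2], continuous H},
        (forall t x, 0 <= t <= 1 -> A x -> B (H (t, x))),
        (forall x, A x -> H (0, x) = f x) &
        (forall x, A x -> H (1, x) = g x)].

Definition homotopy_equivalence (R : realType) (X Y : topologicalType)
    (A : set X) (B : set Y) (f : X -> Y) : Prop :=
  [/\ {within A, continuous f},
      (forall x, A x -> B (f x)) &
      exists g : Y -> X,
        [/\ {within B, continuous g},
            (forall y, B y -> A (g y)),
            homotopic_on R A A (g \o f) id &
            homotopic_on R B B (f \o g) id]].

(* Main.v *)
(* The fibres of ang are convex in polar coordinates, but in general ang has no
   continuous section over Theta = ang(Z): for the line 1 + x + y = 0 the fibres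
   over the three vertices of the coamoeba are intervals on which sections over
   the adjacent triangles have several limit points.  One selects approximately
   instead.  If finitely or countably many points of Z have angles close to
   theta, then in each coordinate they lie in an open half-plane around theta_j,
   so a convex combination of them has nonzero coordinates and stays in Z, since
   Z is cut out by affine equations.  Choosing z_k in Z with dense angles and
   weights supported where |theta - ang z_k| < s gives a continuous map G(s, .)
   from Theta to Z with ang (G(s, theta)) within O(s) of theta.  The homotopy
   inverse is G(1, .): the segment from G(1, ang z) to z stays in Z, and
   ang (G(s, .)) contracts to the identity of Theta as s tends to 0. *)
Require Import Defs.
From HB Require Import structures.
From mathcomp Require Import all_boot all_order all_algebra.
From mathcomp Require Import all_classical all_reals all_analysis.
From mathcomp Require Import complex.
From mathcomp Require Import ring lra.
Import numFieldNormedType.Exports.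
Import Order.TTheory GRing.Theory Num.Theory.
Local Open Scope classical_set_scope.
Local Open Scope ring_scope.

Local Notation re := (@complex.Re _).
Local Notation im := (@complex.Im _).
Local Notation "x %:C" := (real_complex_def (Phant _) x) : ring_scope.

(** * Convergence in [CC R] and in row vectors, read off real coordinates *)

Section ComplexTopology.
Context {R : realType}.
Implicit Types z w : CC R.

Lemma normC_le z : `|z| <= (`|re z| + `|im z|)%:C.
Proof.
rewrite normc_def lecR -(@ler_pXn2r _ 2) ?nnegrE ?sqrtr_ge0 ?addr_ge0//.
rewrite sqr_sqrtr ?addr_ge0 ?sqr_ge0// sqrrD !real_normK ?num_real//.
have := mulr_ge0 (normr_ge0 (re z)) (normr_ge0 (im z)); lra.
Qed.

Lemma normRe_le z : `|re z|%:C <= `|z|.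
Proof. exact: normc_ge_Re. Qed.

Lemma normIm_le z : `|im z|%:C <= `|z|.
Proof.
rewrite normc_def lecR -(sqrtr_sqr (im z)) ler_wsqrtr// lerDr sqr_ge0//.
Qed.

Lemma cvg_CC_ReIm (T : Type) (F : set_system T) (FF : Filter F)
    (f : T -> CC R) (l : CC R) :
  f @ F --> l <->
  (fun t => re (f t)) @ F --> re l /\ (fun t => im (f t)) @ F --> im l.
Proof.
split=> [/cvgrPdist_lt fl|[/cvgrPdist_lt f1 /cvgrPdist_lt f2]].
  split; apply/cvgrPdist_lt => e e0;
  have e0' : (0 : R[i]) < e%:C by rewrite ltcR.
    near=> t; rewrite -ltcR; have := normRe_le (l - f t); rewrite raddfB/=.
    by move=> /le_lt_trans; apply; near: t; exact: fl.
  near=> t; rewrite -ltcR; have := normIm_le (l - f t); rewrite raddfB/=.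
  by move=> /le_lt_trans; apply; near: t; exact: fl.
apply/cvgrPdist_lt => e e0.
(* In the partial order of [R[i]] a positive [e] is real, so it can be traded for [re e] and halved
   between the two coordinates. *)
have eE : e = (re e)%:C by rewrite RRe_real// gtr0_real.
have e0' : 0 < re e / 2 by rewrite divr_gt0// -ltcR -eE.
near=> t; apply: le_lt_trans (normC_le _) _.
rewrite eE ltcR !raddfB/= (splitr (re e)) ltrD//.
  by near: t; exact: f1.
by near: t; exact: f2.
Unshelve. all: by end_near. Qed.

Lemma cvg_rV (T : Type) (F : set_system T) (FF : Filter F) n
    (f : T -> 'rV[CC R]_n) (l : 'rV[CC R]_n) :
  (forall j, (fun t => f t ord0 j) @ F --> l ord0 j) -> f @ F --> l.
Proof.
(* A neighbourhood of a row vector contains a box, given by a matrix [P] of neighbourhoods of its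
   finitely many entries. *)
move=> fl A [P lP PA].
apply: filterS (PA) _.
have : \forall t \near F, forall j, P ord0 j (f t ord0 j).
  by apply: filter_forall => j; apply: fl; exact: lP.
by apply: filterS => t + i j; rewrite (ord1 i); exact.
Qed.

End ComplexTopology.

(** * Normal convergence of real series *)

Section NormalSeries.
Context {R : realType}.

Lemma normal_series_cvg (f M : nat -> R) :
  (forall k, `|f k| <= M k) -> cvgn (series M) -> cvgn (series f).
Proof.
move=> fM cM; apply: normed_cvg; apply: series_le_cvg cM => //= k.
by rewrite (le_trans _ (fM k)).
Qed.

Lemma lim_series_ge_term (f : nat -> R) k0 :
  (forall k, 0 <= f k) -> cvgn (series f) -> f k0 <= limn (series f).
Proof.
move=> f0 cf.
have nd : nondecreasing_seq (series f).
  by apply/nondecreasing_seqP => n; rewrite seriesSr lerDl.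
(* [series f n] sums the indices below [n], so [k0.+1] is the first partial sum that contains
   [f k0]. *)
apply: le_trans (nondecreasing_cvgn_le nd cf k0.+1).
by rewrite seriesSr lerDr sumr_ge0.
Qed.

(** Weierstrass M-test: the tails are bounded by those of [series M] uniformly in the point, so
    continuity passes from one partial sum to the limit by a three-epsilon argument. *)
Lemma normal_series_continuous (T : topologicalType) (f : nat -> T -> R)
    (M : nat -> R) :
  (forall k p, `|f k p| <= M k) -> cvgn (series M) ->
  (forall k, continuous (f k)) ->
  continuous (fun p => limn (series (f ^~ p))).
Proof.
move=> fM cM cf p.
have cs q : cvgn (series (f ^~ q)) by apply: normal_series_cvg cM => k; exact: fM.
have tail N q : `|limn (series (f ^~ q)) - series (f ^~ q) N| <=
    limn (series M) - series M N.
  have cB (u : nat -> R) : cvgn (series u) ->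
      (fun n => series u (n + N)%N - series u N) @ \oo -->
      limn (series u) - series u N.
    by move=> cu; apply: cvgB; [rewrite (cvg_shiftn N)|exact: cvg_cst].
  have h : (fun n => `|series (f ^~ q) (n + N)%N - series (f ^~ q) N|) @ \oo -->
      `|limn (series (f ^~ q)) - series (f ^~ q) N|.
    exact: cvg_norm (cB _ (cs q)).
  apply: (ler_cvg_to h (cB _ cM)); apply: nearW => n.
  rewrite /series/= !sub_series_geq ?leq_addl//.
  by apply: le_trans (ler_norm_sum _ _ _) _; exact: ler_sum.
apply/cvgrPdist_lt => e e0.
have e30 : 0 < e / 3 by rewrite divr_gt0.
have [N MN] : exists N, limn (series M) - series M N < e / 3.
  have /cvgrPdist_lt/(_ _ e30) [N _ /(_ N (leqnn N))/=] := cM.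
  by exists N; apply: le_lt_trans (ler_norm _) _.
have cN : (fun q => series (f ^~ q) N) @ p --> series (f ^~ p) N.
  rewrite /series/=; apply: cvg_big => [|k _]; [exact: add_continuous|exact: cf].
near=> q.
have : `|series (f ^~ p) N - series (f ^~ q) N| < e / 3.
  by near: q; move/cvgrPdist_lt : cN; exact.
move: (tail N p) (tail N q) MN.
rewrite !ler_norml !ltr_norml; lra.
Unshelve. all: by end_near. Qed.

End NormalSeries.

(** * Weighted series of complex numbers *)

Section WeightedSum.
Context {R : realType}.
Implicit Types (z : CC R) (c u : nat -> R) (a b : nat -> CC R).

(** An equivalent norm with values in [R]; the modulus [|z|] is itself an element of [CC R]. *)
Definition norm1 z : R := `|re z| + `|im z|.

Lemma norm1_ge0 z : 0 <= norm1 z.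
Proof. by rewrite addr_ge0. Qed.

Lemma norm1D z w : norm1 (z + w) <= norm1 z + norm1 w.
Proof.
rewrite /norm1 !raddfD/= addrACA.
by apply: lerD; exact: ler_normD.
Qed.

Lemma re_mul z w : re (z * w) = re z * re w - im z * im w.
Proof. by case: z w => ? ? []. Qed.

Lemma im_mul z w : im (z * w) = re z * im w + im z * re w.
Proof. by case: z w => ? ? []. Qed.

Lemma norm1M z w : norm1 (z * w) <= norm1 z * norm1 w.
Proof.
rewrite /norm1 re_mul im_mul.
apply: le_trans (lerD (ler_normB _ _) (ler_normD _ _)) _.
rewrite !normrM le_eqVlt; apply/orP; left; apply/eqP; ring.
Qed.

(** Summability is asked of the dominating weights [c], so that one condition serves every [u] with
    [0 <= u k <= c k], in particular weights that vary with a parameter. *)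
Definition summable_weights c a := cvgn (series (fun k => c k * norm1 (a k))).

Definition wsum u a : CC R :=
  Complex (limn (series (fun k => u k * re (a k))))
          (limn (series (fun k => u k * im (a k)))).

Section fixed_weights.
Variables (c u : nat -> R).
Hypothesis uc : forall k, 0 <= u k <= c k.

Let c_ge0 k : 0 <= c k.
Proof. by have /andP[/le_trans] := uc k; apply. Qed.

Lemma summable_weightsD a b : summable_weights c a -> summable_weights c b ->
  summable_weights c (fun k => a k + b k).
Proof.
move=> ca cb; have := is_cvg_seriesD ca cb.
apply: series_le_cvg => k /=.
- by rewrite mulr_ge0 ?norm1_ge0.
- by apply: addr_ge0; rewrite mulr_ge0 ?norm1_ge0.
- by rewrite fctE -mulrDr ler_wpM2l// norm1D.
Qed.

Lemma summable_weightsM z a : summable_weights c a ->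
  summable_weights c (fun k => z * a k).
Proof.
move=> ca; have := is_cvg_seriesZ (k := norm1 z) ca.
apply: series_le_cvg => k /=.
- by rewrite mulr_ge0 ?norm1_ge0.
- by apply: mulr_ge0; rewrite ?norm1_ge0// mulr_ge0 ?norm1_ge0.
- rewrite (_ : (_ *: _) k = norm1 z * (c k * norm1 (a k)))//.
  by rewrite mulrCA ler_wpM2l// norm1M.
Qed.

Lemma wsum_term_le a k :
  `|u k * re (a k)| <= c k * norm1 (a k) /\
  `|u k * im (a k)| <= c k * norm1 (a k).
Proof.
have /andP[u0 uck] := uc k.
by split; rewrite normrM ger0_norm// ler_pM// /norm1 ?lerDl ?lerDr.
Qed.

Lemma cvg_wsum a : summable_weights c a ->
  cvgn (series (fun k => u k * re (a k))) /\
  cvgn (series (fun k => u k * im (a k))).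
Proof.
move=> ca; split; apply: normal_series_cvg ca => k.
  by have [] := wsum_term_le a k.
by have [] := wsum_term_le a k.
Qed.

Lemma wsumD a b : summable_weights c a -> summable_weights c b ->
  wsum u (fun k => a k + b k) = wsum u a + wsum u b.
Proof.
move=> /cvg_wsum[ra ia] /cvg_wsum[rb ib].
apply/eqP; rewrite eq_complex/=; apply/andP; split; apply/eqP.
  rewrite -lim_seriesD//; congr (limn (series _)); apply/funext => k.
  by rewrite raddfD mulrDr.
rewrite -lim_seriesD//; congr (limn (series _)); apply/funext => k.
by rewrite raddfD mulrDr.
Qed.

Lemma wsumM z a : summable_weights c a ->
  wsum u (fun k => z * a k) = z * wsum u a.
Proof.
move=> /cvg_wsum[ra ia].
apply/eqP; rewrite eq_complex re_mul im_mul/=; apply/andP; split; apply/eqP.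
  rewrite -[X in _ = X - _](lim_seriesZ (re z) ra).
  rewrite -[X in _ = _ - X](lim_seriesZ (im z) ia).
  rewrite -limB; [|exact: is_cvg_seriesZ|exact: is_cvg_seriesZ].
  rewrite -seriesN -seriesD; congr (limn (series _)); apply/funext => k.
  by rewrite re_mul !fctE/= /GRing.scale/=; ring.
rewrite -[X in _ = X + _](lim_seriesZ (re z) ia).
rewrite -[X in _ = _ + X](lim_seriesZ (im z) ra).
rewrite -limD; [|exact: is_cvg_seriesZ|exact: is_cvg_seriesZ].
rewrite -seriesD; congr (limn (series _)); apply/funext => k.
by rewrite im_mul !fctE/= /GRing.scale/=; ring.
Qed.

Lemma wsum_lincomb n (lam : 'I_n -> CC R) (a : 'I_n -> nat -> CC R) :
  (forall j, summable_weights c (a j)) ->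
  wsum u (fun k => \sum_j lam j * a j k) = \sum_j lam j * wsum u (a j).
Proof.
move=> ca.
have fE : (fun k => \sum_j lam j * a j k) = \sum_j (fun k => lam j * a j k).
  by apply/funext => k; rewrite fct_sumE.
rewrite fE.
(* The induction on the finite sum also carries summability, which [wsumD] requires of both
   summands. *)
suff [] : wsum u (\sum_j (fun k => lam j * a j k)) = \sum_j lam j * wsum u (a j) /\
    summable_weights c (\sum_j (fun k => lam j * a j k)) by [].
elim/big_rec2 : _ => [|j f s _ [fs cf]].
  have c0 : summable_weights c 0.
    rewrite /summable_weights (_ : series _ = cst 0); first exact: is_cvg_cst.
    apply/funext => k; rewrite /series/= big1// => i _.
    by rewrite /norm1 normr0 addr0 mulr0.
  split=> //; have := wsumM 0 _ c0; rewrite mul0r => <-.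
  by congr wsum; apply/funext => k; rewrite mul0r.
have caj := summable_weightsM (lam j) _ (ca j).
split; last exact: summable_weightsD.
by rewrite -fs -wsumM// -wsumD.
Qed.

(** A real linear form commutes with the series, and a series of nonnegative terms dominates each of
    them. Where [u k = 0] the term vanishes wherever [a k] lies, so only indices of positive weight
    are constrained. *)
Lemma wsum_halfplane a (x y : R) : summable_weights c a ->
  (forall k, 0 < u k -> 0 <= x * re (a k) + y * im (a k)) ->
  forall k, u k * (x * re (a k) + y * im (a k)) <=
    x * re (wsum u a) + y * im (wsum u a).
Proof.
move=> /cvg_wsum[ra ia] apos k.
have [rZ iZ] := (is_cvg_seriesZ (k := x) ra, is_cvg_seriesZ (k := y) ia).
rewrite -[X in _ <= X + _](lim_seriesZ x ra) -[X in _ <= _ + X](lim_seriesZ y ia).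
set f := x *: _; set g := y *: _.
have fgE i : (f + g) i = u i * (x * re (a i) + y * im (a i)).
  by rewrite /f /g !fctE/= /GRing.scale/= mulrDr; congr (_ + _); rewrite mulrCA.
have fg0 i : 0 <= (f + g) i.
  rewrite fgE; have /andP[] := uc i.
  rewrite le_eqVlt => /predU1P[<-|ui _]; first by rewrite mul0r.
  by rewrite mulr_ge0 ?(ltW ui)// apos.
rewrite -fgE -lim_seriesD//; apply: lim_series_ge_term => //.
exact: is_cvg_seriesD.
Qed.

Lemma wsum_halfplane_ge0 a (x y : R) : summable_weights c a ->
  (forall k, 0 < u k -> 0 <= x * re (a k) + y * im (a k)) ->
  0 <= x * re (wsum u a) + y * im (wsum u a).
Proof.
(* Any single term is a nonnegative lower bound; the term of index 0 is taken. *)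
move=> ca apos; apply: le_trans (wsum_halfplane _ _ _ ca apos 0%N).
have /andP[] := uc 0%N; rewrite le_eqVlt => /predU1P[<-|u0 _]; first by rewrite mul0r.
by rewrite mulr_ge0 ?(ltW u0)// apos.
Qed.

Lemma wsum_halfplane_gt0 a (x y : R) : summable_weights c a ->
  (forall k, 0 < u k -> 0 < x * re (a k) + y * im (a k)) ->
  (exists k, 0 < u k) ->
  0 < x * re (wsum u a) + y * im (wsum u a).
Proof.
move=> ca apos [k uk]; apply: lt_le_trans (wsum_halfplane _ _ _ ca _ k).
  by rewrite mulr_gt0// apos.
by move=> i ui; rewrite ltW// apos.
Qed.

End fixed_weights.

(** The M-test applies to the real and the imaginary part, both with majorant
    [c k * norm1 (a k)]. *)
Lemma wsum_continuous (T : topologicalType) (u : nat -> T -> R) c a :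
  (forall k p, 0 <= u k p <= c k) -> (forall k, continuous (u k)) ->
  summable_weights c a -> continuous (fun p => wsum (u ^~ p) a).
Proof.
move=> uc cu ca p; apply/cvg_CC_ReIm; split=> /=.
  apply: (normal_series_continuous _ (fun k p => u k p * re (a k)) _ _ ca).
    by move=> k q; have [] := wsum_term_le _ _ (uc^~ q) a k.
  by move=> k q; apply: cvgMl; exact: cu.
apply: (normal_series_continuous _ (fun k p => u k p * im (a k)) _ _ ca).
  by move=> k q; have [] := wsum_term_le _ _ (uc^~ q) a k.
by move=> k q; apply: cvgMl; exact: cu.
Qed.

End WeightedSum.

(** * Half-planes and cones around a direction *)

Section Cones.
Context {R : realType}.
Implicit Types t v w : CC R.

(** [dotC t v] and [crossC t v] are the real and imaginary parts of $\bar t v$: for a unit [t], the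
    coordinates of [v] in the frame rotated so that [t] is the positive real direction. *)
Definition dotC t v : R := re t * re v + im t * im v.
Definition crossC t v : R := re t * im v - im t * re v.

Lemma normC_realE v : `|v| = (Num.sqrt (re v ^+ 2 + im v ^+ 2))%:C.
Proof. exact: normc_def. Qed.

Lemma unit_sqr t : `|t| = 1 -> re t ^+ 2 + im t ^+ 2 = 1.
Proof.
rewrite normC_realE => -[/(congr1 (fun x => x ^+ 2))].
by rewrite expr1n sqr_sqrtr// addr_ge0 ?sqr_ge0.
Qed.

Lemma re_realM (r : R) v : re (r%:C * v) = r * re v.
Proof. by rewrite re_mul [im _%:C]/= mul0r subr0. Qed.

Lemma im_realM (r : R) v : im (r%:C * v) = r * im v.
Proof. by rewrite im_mul [im _%:C]/= mul0r addr0. Qed.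

Lemma dotCD t v w : dotC t (v + w) = dotC t v + dotC t w.
Proof. by rewrite /dotC !raddfD/= !mulrDr addrACA. Qed.

Lemma dotC_realM (r : R) t v : dotC t (r%:C * v) = r * dotC t v.
Proof. by rewrite /dotC re_realM im_realM mulrDr !(mulrCA _ r). Qed.

(** The radius [r] is [|v|] read as an element of [R]; inequalities homogeneous in [v] thereby
    reduce to the unit vector. *)
Lemma polarC v : v != 0 -> exists2 r : R, 0 < r &
  [/\ re v = r * re (v / `|v|), im v = r * im (v / `|v|) & `|v / `|v| | = 1].
Proof.
move=> v0; pose r := Num.sqrt (re v ^+ 2 + im v ^+ 2).
have nv : `|v| = r%:C by exact: normC_realE.
have r0 : 0 < r by rewrite -ltcR -nv normr_gt0.
have vE : v = r%:C * (v / `|v|) by rewrite -nv mulrC divfK// normr_eq0.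
exists r => //; split.
- by rewrite [in LHS]vE re_realM.
- by rewrite [in LHS]vE im_realM.
- by rewrite normf_div normr_id divff// normr_eq0.
Qed.

(** For a unit [t] one has [dotC t w = 1 + dotC t (w - t)], and the coordinates of [t] are at most 1
    in absolute value. *)
Lemma unit_dot_ge t w : `|t| = 1 -> `|w| = 1 -> 1 - norm1 (w - t) <= dotC t w.
Proof.
move=> /unit_sqr t1 /unit_sqr w1; rewrite /norm1 /dotC !raddfB/=.
move: t1 w1; set a := re t; set b := im t; set x := re w; set y := im w => t1 w1.
have a1 : `|a| <= 1 by rewrite ler_norml; apply/andP; split; nra.
have b1 : `|b| <= 1 by rewrite ler_norml; apply/andP; split; nra.
have h1 : `|(x - a) * a| <= `|x - a| by rewrite normrM ler_piMr.
have h2 : `|(y - b) * b| <= `|y - b| by rewrite normrM ler_piMr.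
move: h1 h2; rewrite [`|_ * a| <= _]ler_norml [`|_ * b| <= _]ler_norml; nra.
Qed.

(** Since [crossC t t = 0], only the difference [w - t] contributes. *)
Lemma unit_cross_le t w : `|t| = 1 -> `|crossC t w| <= norm1 (w - t).
Proof.
move=> /unit_sqr t1; rewrite /norm1 /crossC !raddfB/=.
move: t1; set a := re t; set b := im t; set x := re w; set y := im w => t1.
have a1 : `|a| <= 1 by rewrite ler_norml; apply/andP; split; nra.
have b1 : `|b| <= 1 by rewrite ler_norml; apply/andP; split; nra.
have -> : a * y - b * x = (y - b) * a - (x - a) * b by ring.
rewrite [leRHS]addrC; apply: le_trans (ler_normB _ _) _.
by rewrite !normrM lerD// ler_piMr.
Qed.

Lemma dotC_gt0_neq0 t v : 0 < dotC t v -> v != 0.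
Proof.
by apply: contraTneq => ->; rewrite /dotC/= !mulr0 addr0 ltxx.
Qed.

Lemma ang_near_dot_gt0 t v : `|t| = 1 -> v != 0 ->
  norm1 (v / `|v| - t) < 1 -> 0 < dotC t v.
Proof.
move=> t1 /polarC[r r0 [rv iv w1]] d1; have := unit_dot_ge _ _ t1 w1.
rewrite /dotC rv iv; move: d1; set d := norm1 _ => d1 h.
by rewrite mulrCA [im t * _]mulrCA -mulrDr mulr_gt0//; apply: lt_le_trans h; lra.
Qed.

(** The conclusion puts [v] in a convex cone around [t], with denominators cleared. At distance
    [d <= s] the unit vector has cross part at most [d] and dot part at least [1 - d], and
    [(1 - s) * d <= s * (1 - d)] amounts to [d <= s]. *)
Lemma ang_near_cone t v s : `|t| = 1 -> v != 0 -> s <= 1 ->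
  norm1 (v / `|v| - t) <= s ->
  (1 - s) * `|crossC t v| <= s * dotC t v.
Proof.
move=> t1 /polarC[r r0 [rv iv w1]] s1 ds.
have := unit_dot_ge _ _ t1 w1; have := unit_cross_le _ (v / `|v|) t1.
have d0 := norm1_ge0 (v / `|v| - t).
rewrite /dotC /crossC rv iv; move: d0 ds; set d := norm1 _ => d0 ds h1 h2.
rewrite mulrCA [im t * _]mulrCA [re t * (r * _)]mulrCA [im t * (r * _)]mulrCA.
rewrite -mulrDr -mulrBr normrM (gtr0_norm r0) mulrCA [s * _]mulrCA ler_pM2l//.
apply: (@le_trans _ _ ((1 - s) * d)); first by rewrite ler_wpM2l// subr_ge0.
apply: (@le_trans _ _ (s * (1 - d))); first by nra.
by rewrite ler_wpM2l// (le_trans d0).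
Qed.

(** A converse with a loss of constant. With [p], [q] the rotated coordinates of the unit vector,
    [(1 - s) * |q| <= s] and [s <= 1/2] give [|q| <= 2 * s], hence also [1 - p <= 2 * s]. *)
Lemma cone_ang_near t v s : `|t| = 1 -> 0 <= s <= 2^-1 ->
  0 < dotC t v -> (1 - s) * `|crossC t v| <= s * dotC t v ->
  norm1 (v / `|v| - t) <= 8 * s.
Proof.
move=> t1 /andP[s0 s2] vt vc; have /polarC[r r0 [rv iv w1]] := dotC_gt0_neq0 _ _ vt.
move: vt vc; rewrite /norm1 !raddfB/= /dotC /crossC rv iv.
move: (unit_sqr _ t1) (unit_sqr _ w1).
set a := re t; set b := im t; set x := re (v / _); set y := im (v / _) => {}t1 {}w1.
rewrite mulrCA [b * _]mulrCA [a * (r * _)]mulrCA [b * (r * _)]mulrCA.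
rewrite -mulrDr -mulrBr normrM (gtr0_norm r0) mulrCA [s * _]mulrCA.
rewrite ler_pM2l// pmulr_rgt0//.
set p := a * x + b * y; set q := a * y - b * x => p0 pq.
have pq1 : p ^+ 2 + q ^+ 2 = 1.
  by rewrite /p /q -[1]mulr1 -{1}t1 -w1; ring.
have p1 : p <= 1 by nra.
have q2 : `|q| <= 2 * s.
  have := normr_ge0 q; nra.
(* Both [p] and [|q|] are nonnegative with squares summing to 1, so their sum is at least 1. *)
have p2 : 1 - p <= `|q|.
  have := real_normK (num_real q); have := normr_ge0 q; nra.
have a1 : `|a| <= 1 by rewrite ler_norml; apply/andP; split; nra.
have b1 : `|b| <= 1 by rewrite ler_norml; apply/andP; split; nra.
(* Here and in [yE], $w - t = (p-1)t + q\,i\,t$ coordinatewise. Each coordinate is at most [4 * s],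
   whence the constant 8. *)
have xE : x - a = (p - 1) * a - q * b.
  have : p * a - q * b = x * (a ^+ 2 + b ^+ 2) by rewrite /p /q; ring.
  by rewrite t1 mulr1 => {1}<-; ring.
have yE : y - b = (p - 1) * b + q * a.
  have : p * b + q * a = y * (a ^+ 2 + b ^+ 2) by rewrite /p /q; ring.
  by rewrite t1 mulr1 => {1}<-; ring.
have pn : `|p - 1| <= 2 * s by rewrite distrC ger0_norm ?subr_ge0//; lra.
have s20 : 0 <= 2 * s by lra.
have M c e : `|c| <= 2 * s -> `|e| <= 1 -> `|c * e| <= 2 * s.
  by move=> h1 h2; rewrite normrM -[2 * s]mulr1 ler_pM.
have := ler_normB ((p - 1) * a) (q * b); have := ler_normD ((p - 1) * b) (q * a).
have := M _ _ pn a1; have := M _ _ pn b1; have := M _ _ q2 a1; have := M _ _ q2 b1.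
rewrite -xE -yE; lra.
Qed.

End Cones.

(** * Continuous weighted averages of a sequence in the torus *)

Section Averaging.
Context {R : realType} {n : nat}.
Implicit Types (th : 'rV[CC R]_n) (s : R).

Definition dist1 th th' : R := \sum_j norm1 (th ord0 j - th' ord0 j).

Lemma norm1_distC (z w : CC R) : norm1 (z - w) = norm1 (w - z).
Proof. by rewrite /norm1 !raddfB/= distrC [in X in _ + X]distrC. Qed.

Lemma dist1_ge0 th th' : 0 <= dist1 th th'.
Proof. by apply: sumr_ge0 => j _; exact: norm1_ge0. Qed.

Lemma norm1_le_dist1 th th' j : norm1 (th ord0 j - th' ord0 j) <= dist1 th th'.
Proof.
by rewrite /dist1 (bigD1 j)//= lerDl sumr_ge0// => i _; exact: norm1_ge0.
Qed.

Lemma cvg_norm1 (T : Type) (F : set_system T) (FF : Filter F) (f : T -> CC R) l :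
  f @ F --> l -> (fun t => norm1 (f t)) @ F --> norm1 l.
Proof.
by move=> /cvg_CC_ReIm[fr fi]; apply: cvgD; exact: cvg_norm.
Qed.

Lemma dist1_continuous th' : continuous (dist1^~ th').
Proof.
rewrite /dist1; apply: continuous_big => [|j _]; first exact: add_continuous.
move=> th; apply: (@cvg_norm1 _ (nbhs th)).
by apply: cvgB; [exact: coord_continuous|exact: cvg_cst].
Qed.

Variable zz : nat -> 'rV[CC R]_n.
Hypothesis zz_torus : forall k, torus (zz k).

(* The denominator makes all the series of the construction converge normally,
   whatever the growth of [zz]. *)
Definition coef k : R := 2^-1 ^+ k / (1 + \sum_j norm1 (zz k ord0 j)).

Lemma coef_den_gt0 k : 0 < 1 + \sum_j norm1 (zz k ord0 j).
Proof. by rewrite ltr_pwDl// sumr_ge0// => j _; exact: norm1_ge0. Qed.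

Lemma coef_gt0 k : 0 < coef k.
Proof. by rewrite divr_gt0 ?coef_den_gt0// exprn_gt0// invr_gt0. Qed.

(** The pair [p] holds the scale and the angle vector. The radius is capped at 1 so that points of
    positive weight lie in the open half-planes of [ang_near_dot_gt0]; the cap also bounds the
    weight by [coef k]. *)
Definition weight k (p : R * 'rV[CC R]_n) : R :=
  coef k * Num.max 0 (Num.min 1 p.1 - dist1 p.2 (ang (zz k))).

Lemma weight_bounds k p : 0 <= weight k p <= coef k.
Proof.
rewrite /weight mulr_ge0 ?(ltW (coef_gt0 _)) ?le_max ?lexx//=.
rewrite ger_pMr ?coef_gt0// ge_max ler01/=.
by rewrite lerBlDr (@le_trans _ _ 1)// ?ge_min ?lexx// lerDl dist1_ge0.
Qed.

Lemma weight_gt0 k p :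
  (0 < weight k p) = (dist1 p.2 (ang (zz k)) < Num.min 1 p.1).
Proof. by rewrite /weight pmulr_rgt0 ?coef_gt0// lt_max ltxx/= subr_gt0. Qed.

Lemma weight_continuous k : continuous (weight k).
Proof.
move=> p.
pose d (q : R * 'rV[CC R]_n) : R := dist1 q.2 (ang (zz k)).
have cd : {for p, continuous d}.
  apply: (@cvg_comp _ _ _ snd (dist1^~ (ang (zz k))) (nbhs p) (nbhs p.2)).
    exact: cvg_snd.
  exact: dist1_continuous.
have cm : {for p, continuous (fun q : R * 'rV[CC R]_n => Num.min 1 q.1)}.
  apply: (@continuous_min _ _ (fun=> 1) fst p); first exact: cvg_cst.
  exact: cvg_fst.
pose g (q : R * 'rV[CC R]_n) : R := Num.min 1 q.1 - d q.
have cg : {for p, continuous g} by exact: cvgB.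
have cM : {for p, continuous (fun q => Num.max 0 (g q))}.
  by apply: (@continuous_max _ _ (fun=> 0) g p) cg; exact: cvg_cst.
exact: cvgMr.
Qed.

Lemma summable_geometric (a : nat -> CC R) :
  (forall k, norm1 (a k) <= 1 + \sum_j norm1 (zz k ord0 j)) ->
  summable_weights coef a.
Proof.
move=> aB; have := @is_cvg_geometric_series R 1 2^-1.
rewrite ger0_norm// invf_lt1// ltr1n => /(_ isT).
apply: series_le_cvg => k /=.
- by rewrite mulr_ge0 ?norm1_ge0// ltW// coef_gt0.
- by rewrite mul1r exprn_ge0.
- rewrite mul1r /coef -mulrA ler_piMr ?exprn_ge0//.
  by rewrite ler_pdivrMl ?coef_den_gt0// mulr1.
Qed.

Lemma summable_coord j : summable_weights coef (fun k => zz k ord0 j).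
Proof.
apply: summable_geometric => k; rewrite (bigD1 j)//= addrCA lerDl.
by rewrite addr_ge0// sumr_ge0// => i _; exact: norm1_ge0.
Qed.

Lemma summable_one : summable_weights coef (fun=> 1).
Proof.
apply: summable_geometric => k; rewrite /norm1/= normr1 normr0 addr0 lerDl.
by rewrite sumr_ge0// => i _; exact: norm1_ge0.
Qed.

(** Written as a [wsum], hence complex, so that the same lemmas treat the numerator and the
    denominator of [average]. *)
Definition mass p : CC R := wsum (weight ^~ p) (fun=> 1).

Definition average (p : R * 'rV[CC R]_n) : 'rV[CC R]_n :=
  \row_j (wsum (weight ^~ p) (fun k => zz k ord0 j) / mass p).

(** Equivalent to some weight being positive, by [weight_gt0]. Otherwise [mass p] is 0 and the
    division in [average] returns the default value 0. *)
Definition reached (p : R * 'rV[CC R]_n) :=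
  exists k, dist1 p.2 (ang (zz k)) < Num.min 1 p.1.

Section reached.
Variable p : R * 'rV[CC R]_n.
Hypothesis rp : reached p.

Let wb k := weight_bounds k p.

Let ex_weight_gt0 : exists k, 0 < weight k p.
Proof. by have [k ?] := rp; exists k; rewrite weight_gt0. Qed.

Lemma mass_real : exists2 r : R, 0 < r & mass p = r%:C.
Proof.
exists (re (mass p)).
  have one_gt0 k : 0 < weight k p -> 0 < 1 * re (1 : CC R) + 0 * im (1 : CC R).
    by rewrite /= mul1r mul0r addr0.
  have := wsum_halfplane_gt0 _ _ wb _ _ _ summable_one one_gt0 ex_weight_gt0.
  by rewrite mul1r mul0r addr0.
apply/eqP; rewrite eq_complex/= eqxx/=; apply/eqP.
rewrite (_ : series _ = cst 0) ?lim_cst//.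
by apply/funext => k; rewrite /series/= big1// => i _; rewrite mulr0.
Qed.

Lemma mass_neq0 : mass p != 0.
Proof.
by have [r r0 ->] := mass_real; rewrite eq_complex/= negb_and gt_eqF.
Qed.

Lemma average_halfplane_gt0 j (x y : R) :
  (forall k, 0 < weight k p -> 0 < x * re (zz k ord0 j) + y * im (zz k ord0 j)) ->
  0 < x * re (average p ord0 j) + y * im (average p ord0 j).
Proof.
move=> zpos; have [r r0 mE] := mass_real.
have := wsum_halfplane_gt0 _ _ wb _ x y (summable_coord j) zpos ex_weight_gt0.
have -> : wsum (weight ^~ p) (fun k => zz k ord0 j) = r%:C * average p ord0 j.
  by rewrite mxE mE mulrC divfK// -mE mass_neq0.
by rewrite re_realM im_realM mulrCA [y * _]mulrCA -mulrDr pmulr_rgt0.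
Qed.

Lemma average_halfplane_ge0 j (x y : R) :
  (forall k, 0 < weight k p -> 0 <= x * re (zz k ord0 j) + y * im (zz k ord0 j)) ->
  0 <= x * re (average p ord0 j) + y * im (average p ord0 j).
Proof.
move=> zpos; have [r r0 mE] := mass_real.
have := wsum_halfplane_ge0 _ _ wb _ x y (summable_coord j) zpos.
have -> : wsum (weight ^~ p) (fun k => zz k ord0 j) = r%:C * average p ord0 j.
  by rewrite mxE mE mulrC divfK// -mE mass_neq0.
by rewrite re_realM im_realM mulrCA [y * _]mulrCA -mulrDr pmulr_rge0.
Qed.

Lemma average_affine m (A : 'M[CC R]_(m, n)) (b : 'cV[CC R]_m) :
  (forall k, A *m (zz k)^T = b) -> A *m (average p)^T = b.
Proof.
move=> Azz; apply/matrixP => i j; rewrite (ord1 j) mxE.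
transitivity ((\sum_j A i j * wsum (weight ^~ p) (fun k => zz k ord0 j)) / mass p).
  rewrite mulr_suml; apply: eq_bigr => l _; by rewrite !mxE mulrA.
rewrite -(wsum_lincomb _ _ wb _ _ _ summable_coord).
(* Row [i] of the equations is constant in [k]; its weighted sum is [b i ord0 * mass p], and the
   normalization cancels the mass. *)
rewrite (_ : (fun k => _) = fun k => b i ord0 * 1).
  by rewrite (wsumM _ _ wb _ _ summable_one) mulfK// mass_neq0.
apply/funext => k; rewrite mulr1 -(Azz k) mxE.
by apply: eq_bigr => l _; rewrite mxE.
Qed.

Lemma average_continuous : {for p, continuous average}.
Proof.
apply: cvg_rV => j; rewrite mxE.
have cw a : summable_weights coef a -> continuous (fun q => wsum (weight ^~ q) a).
  by apply: wsum_continuous; [exact: weight_bounds|exact: weight_continuous].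
under eq_fun do rewrite mxE.
apply: cvgM; first exact: (cw _ (summable_coord j)).
by apply: cvgV; [exact: mass_neq0|exact: (cw _ summable_one)].
Qed.

Hypothesis th_circle : circle_torus p.2.

Let coord_near k j : 0 < weight k p ->
  norm1 (zz k ord0 j / `|zz k ord0 j| - p.2 ord0 j) < Num.min 1 p.1.
Proof.
rewrite weight_gt0; apply: le_lt_trans.
apply: le_trans (norm1_le_dist1 _ _ j).
by rewrite norm1_distC mxE.
Qed.

(** Every point of positive weight has its coordinate [j] in the open half-plane around
    [p.2 ord0 j], and half-planes are stable under averaging. *)
Lemma average_dot_gt0 j : 0 < dotC (p.2 ord0 j) (average p ord0 j).
Proof.
apply: average_halfplane_gt0 => k wk.
apply: ang_near_dot_gt0 => //; [exact: zz_torus|].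
by have := coord_near k j wk; rewrite lt_min => /andP[].
Qed.

Lemma average_torus : torus (average p).
Proof. by move=> j; exact: dotC_gt0_neq0 (average_dot_gt0 j). Qed.

(** Nearby angles put the weighted points in a cone by [ang_near_cone], the cone is convex, and
    [cone_ang_near] turns membership of the average back into nearness. The factor [n] counts
    coordinates. *)
Lemma ang_average_near : p.1 <= 2^-1 -> dist1 (ang (average p)) p.2 <= 8 * p.1 *+ n.
Proof.
move=> p12.
have p0 : 0 <= p.1.
  have [k] := rp; rewrite lt_min => /andP[_ /(le_lt_trans (dist1_ge0 _ _))].
  exact: ltW.
suff h j : norm1 (ang (average p) ord0 j - p.2 ord0 j) <= 8 * p.1.
  rewrite -[X in _ *+ X]card_ord -sumr_const; apply: ler_sum => j _; exact: h.
rewrite mxE; apply: cone_ang_near => //; [by rewrite p0|exact: average_dot_gt0|].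
set t := p.2 ord0 j.
have cone k : 0 < weight k p ->
    (1 - p.1) * `|crossC t (zz k ord0 j)| <= p.1 * dotC t (zz k ord0 j).
  move=> wk; apply: ang_near_cone; [exact: th_circle|exact: zz_torus|lra|].
  by have := coord_near k j wk; rewrite lt_min => /andP[_ /ltW].
have p11 : 0 <= 1 - p.1 by lra.
have lin (e : R) (v : CC R) : p.1 * dotC t v - e * ((1 - p.1) * crossC t v) =
    (p.1 * re t + e * (1 - p.1) * im t) * re v +
    (p.1 * im t - e * (1 - p.1) * re t) * im v by rewrite /dotC /crossC; ring.
(* The cone is the intersection of two half-planes, one for each sign [e]; [lin] writes their
   equations in the form expected by [average_halfplane_ge0]. *)
have side (e : R) : `|e| = 1 ->
    e * ((1 - p.1) * crossC t (average p ord0 j)) <= p.1 * dotC t (average p ord0 j).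
  move=> e1; rewrite -subr_ge0 lin; apply: average_halfplane_ge0 => k wk.
  rewrite -lin subr_ge0; apply: le_trans (cone k wk).
  by rewrite (le_trans (ler_norm _))// 2!normrM e1 mul1r (ger0_norm p11).
have := side 1 (normr1 _); have := side (-1) (normrN1 _).
rewrite mul1r mulN1r -{3}(ger0_norm p11) -normrM ler_norml => h1 h2.
by rewrite h2 andbT; lra.
Qed.

End reached.

End Averaging.

(** * Sequences with dense image *)

Section Density.
Context {R : realType} {n : nat} {T : Type}.

(** The index holds a mesh [1 / (N + 1)] and one lattice point per complex coordinate, so the
    indices form a countable type. *)
Definition grid_cell (f : T -> 'rV[CC R]_n) (Z : set T)
    (c : nat * {ffun 'I_n -> int * int}) : set T :=
  [set z | Z z /\ forall j : 'I_n,
    `|c.1.+1%:R * re (f z ord0 j) - (c.2 j).1%:~R| <= 1 /\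
    `|c.1.+1%:R * im (f z ord0 j) - (c.2 j).2%:~R| <= 1].

Lemma grid_cell_close f Z c z z' : grid_cell f Z c z -> grid_cell f Z c z' ->
  dist1 (f z) (f z') <= 4 / c.1.+1%:R *+ n.
Proof.
move=> [_ cz] [_ cz'].
rewrite -[X in _ *+ X]card_ord -sumr_const; apply: ler_sum => j _.
have N0 : 0 < c.1.+1%:R :> R by rewrite ltr0n.
rewrite ler_pdivlMr// mulrC /norm1 !raddfB/= mulrDr.
rewrite -[X in X * _ + _](gtr0_norm N0) -[X in _ + X * _](gtr0_norm N0).
rewrite -!normrM !mulrBr.
have [] := cz j; have [] := cz' j.
move: (c.1.+1%:R * re (f z ord0 j)) (c.1.+1%:R * re (f z' ord0 j)) => a a'.
move: (c.1.+1%:R * im (f z ord0 j)) (c.1.+1%:R * im (f z' ord0 j)) => b b'.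
move: ((c.2 j).1%:~R) ((c.2 j).2%:~R) => x y.
rewrite !ler_norml => /andP[h1 h2] /andP[h3 h4] /andP[h5 h6] /andP[h7 h8].
have -> : (4 : R) = 2 + 2 by rewrite -natrD.
by apply: lerD; rewrite ler_norml; apply/andP; split; lra.
Qed.

Lemma dense_sequence (f : T -> 'rV[CC R]_n) (Z : set T) : Z !=set0 ->
  exists2 zz : nat -> T, forall k, Z (zz k) &
    forall z (s : R), Z z -> 0 < s -> exists k, dist1 (f z) (f (zz k)) < s.
Proof.
case=> z0 Zz0.
(* [z0] serves the integers that code no cell or an empty one, keeping the whole sequence in [Z]. *)
pose zz k := match @unpickle (nat * {ffun 'I_n -> int * int})%type k with
  | Some c => if pselect (grid_cell f Z c !=set0) is left e then projT1 (cid e) else z0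
  | None => z0 end.
exists zz => [k|z s Zz s0].
  rewrite /zz; case: unpickle => // c; case: pselect => // e.
  by case: (projT2 (cid e)).
(* Chosen so that [N + 1] exceeds [4 * n / s], which brings the bound of [grid_cell_close] below
   [s]. *)
pose N := Num.truncn (4 *+ n / s).
pose v : {ffun 'I_n -> int * int} := [ffun j =>
  (Num.floor (N.+1%:R * re (f z ord0 j)), Num.floor (N.+1%:R * im (f z ord0 j)))].
have fl (x : R) : `|x - (Num.floor x)%:~R| <= 1.
  have /andP[] := floor_itv x; rewrite intrD => h1 h2.
  by rewrite ler_norml; apply/andP; split; lra.
have cz : grid_cell f Z (N, v) z by split=> // j; rewrite ffunE/=; split; exact: fl.
exists (pickle (N, v)); rewrite /zz pickleK; case: pselect => [e|].
  2: by case; exists z.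
apply: le_lt_trans (grid_cell_close _ _ _ _ _ cz (projT2 (cid e))) _ => /=.
rewrite -mulrnAl ltr_pdivrMr ?ltr0n// mulrC -ltr_pdivrMr//.
exact: truncnS_gt.
Qed.

End Density.

Lemma cvg0_norm1_le (R : realType) (T : Type) (F : set_system T) (FF : Filter F)
    (f : T -> CC R) (B : T -> R) :
  (\forall t \near F, norm1 (f t) <= B t) -> B @ F --> 0 -> f @ F --> 0.
Proof.
move=> fB /cvgrPdist_lt B0; apply/cvg_CC_ReIm.
split; apply/cvgrPdist_lt => e e0; near=> t; rewrite sub0r normrN.
  apply: (@le_lt_trans _ _ (B t)).
    by apply: (@le_trans _ _ (norm1 (f t))); [rewrite lerDl|near: t].
  apply: le_lt_trans (ler_norm _) _; rewrite -normrN -sub0r.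
  by near: t; exact: B0.
apply: (@le_lt_trans _ _ (B t)).
  by apply: (@le_trans _ _ (norm1 (f t))); [rewrite lerDr|near: t].
apply: le_lt_trans (ler_norm _) _; rewrite -normrN -sub0r.
by near: t; exact: B0.
Unshelve. all: by end_near. Qed.

(** * The angle map on the torus *)

Section Angle.
Context {R : realType} {n : nat}.
Implicit Types x : 'rV[CC R]_n.

Lemma ang_circle x : torus x -> circle_torus (ang x).
Proof. by move=> xT j; rewrite mxE; have [] := polarC _ (xT j) => r _ []. Qed.

Lemma ang_dot_gt0 x j : torus x -> 0 < dotC (ang x ord0 j) (x ord0 j).
Proof.
move=> xT; apply: ang_near_dot_gt0; [exact: ang_circle|exact: xT|].
by rewrite mxE subrr /norm1/= normr0 addr0.
Qed.

Lemma ang_continuous x : torus x -> {for x, continuous (@ang R n)}.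
Proof.
move=> xT; apply: (@cvg_rV _ _ (nbhs x)) => j; rewrite mxE.
under eq_fun do rewrite mxE.
apply: cvgM; first exact: coord_continuous.
apply: cvgV; first by rewrite normr_eq0.
by apply: cvg_norm; exact: coord_continuous.
Qed.

End Angle.

Lemma continuous_pair (T U V : topologicalType) (f : T -> U) (h : T -> V) x :
  {for x, continuous f} -> {for x, continuous h} ->
  {for x, continuous (fun y => (f y, h y))}.
Proof. by move=> cf ch; exact: (cvg_pair cf ch). Qed.

(** * The homotopy inverse and the two homotopies *)

Section HomotopyEquivalence.
Context {R : realType} {n m : nat}.
Variables (A : 'M[CC R]_(m, n)) (b : 'cV[CC R]_m).
Let Z := [set x : 'rV[CC R]_n | torus x /\ A *m x^T = b].
Let Theta := (@ang R n) @` Z.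

Variable zz : nat -> 'rV[CC R]_n.
Hypothesis zzZ : forall k, Z (zz k).
Hypothesis zz_dense : forall z (s : R), Z z -> 0 < s ->
  exists k, dist1 (ang z) (ang (zz k)) < s.

Let zz_torus k : torus (zz k).
Proof. by case: (zzZ k). Qed.

Let reached_Theta s th : 0 < s -> Theta th -> reached zz (s, th).
Proof.
by move=> s0 [z Zz <-]; apply: zz_dense => //; rewrite lt_min ltr01.
Qed.

Let Theta_circle th : Theta th -> circle_torus th.
Proof. by move=> [z [zT _] <-]; exact: ang_circle. Qed.

Let average_Z s th : 0 < s -> Theta th -> Z (average zz (s, th)).
Proof.
move=> s0 Tth; have rp := reached_Theta _ _ s0 Tth; split.
  by apply: average_torus => //; exact: Theta_circle.
by apply: average_affine => // k; case: (zzZ k).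
Qed.

Let g th := average zz (1, th).

Let cvg_complexR (T : Type) (F : set_system T) (FF : Filter F) (f : T -> R) (l : R) :
  f @ F --> l -> (fun t => (f t)%:C : CC R) @ F --> (l%:C : CC R).
Proof. by move=> fl; apply/cvg_CC_ReIm; split => //=; exact: cvg_cst. Qed.

Let g_continuous th : Theta th -> {for th, continuous g}.
Proof.
move=> Tth; apply: (@continuous_comp _ _ _ (fun th => (1 : R, th)) (average zz)).
  apply: (@continuous_pair 'rV[CC R]_n R 'rV[CC R]_n (fun=> 1) id th).
    exact: cst_continuous.
  exact: cvg_id.
by apply: average_continuous => //; exact: reached_Theta.
Qed.

Let segment (p : R * 'rV[CC R]_n) : 'rV[CC R]_n :=
  (1 - p.1)%:C *: g (ang p.2) + p.1%:C *: p.2.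

Let segment_Z t z : 0 <= t <= 1 -> Z z -> Z (segment (t, z)).
Proof.
move=> /andP[t0 t1] Zz; have [zT Az] := Zz.
have Tz : Theta (ang z) by exists z.
have [gT Ag] := average_Z _ _ ltr01 Tz.
split; last first.
  rewrite linearD/= !linearZ/= mulmxDr -!scalemxAr Az Ag -scalerDl.
  by rewrite -raddfD/= subrK scale1r.
move=> j; rewrite mxE [X in X + _]mxE [X in _ + X]mxE.
(* Both ends of the segment lie in the open half-plane around [ang z ord0 j], so no point between
   them has a zero coordinate. *)
apply: (@dotC_gt0_neq0 _ (ang z ord0 j)).
have dg : 0 < dotC (ang z ord0 j) (g (ang z) ord0 j).
  apply: (@average_dot_gt0 _ _ _ _ (1, ang z)) => //; first exact: reached_Theta.
  exact: Theta_circle.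
have dz := ang_dot_gt0 _ j zT.
rewrite dotCD !dotC_realM.
have [->|tn0] := eqVneq t 0; first by rewrite subr0 mul1r mul0r addr0.
have tp : 0 < t by rewrite lt_def tn0.
by rewrite ltr_wpDl// ?mulr_gt0// mulr_ge0 ?subr_ge0// ltW.
Qed.

Let segment_continuous t z : Z z -> {for (t, z), continuous segment}.
Proof.
move=> Zz; have [zT _] := Zz.
pose P := (R * 'rV[CC R]_n)%type.
have c1 : (fun p : P => (p.1%:C : CC R)) @ nbhs (t, z) --> (t%:C : CC R).
  by apply: cvg_complexR; exact: cvg_fst.
have c2 : (fun p : P => ((1 - p.1)%:C : CC R)) @ nbhs (t, z) --> ((1 - t)%:C : CC R).
  by apply: cvg_complexR; apply: cvgB; [exact: cvg_cst|exact: cvg_fst].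
have c3 j : (fun p : P => p.2 ord0 j) @ nbhs (t, z) --> z ord0 j.
  apply: (@continuous_comp _ _ _ snd (fun M : 'rV[CC R]_n => M ord0 j) (t, z)).
    exact: cvg_snd.
  exact: coord_continuous.
have c4 j : (fun p : P => g (ang p.2) ord0 j) @ nbhs (t, z) --> g (ang z) ord0 j.
  apply: (@continuous_comp _ _ _ (fun p : P => g (ang p.2))
    (fun M : 'rV[CC R]_n => M ord0 j) (t, z)).
    apply: (@continuous_comp _ _ _ snd (fun x => g (ang x)) (t, z)).
      exact: cvg_snd.
    apply: (@continuous_comp _ _ _ (@ang R n) g); first exact: ang_continuous.
    by apply: g_continuous; exists z.
  exact: coord_continuous.
apply: (@cvg_rV _ _ (nbhs (t, z))) => j.
have sE p : segment p ord0 j = (1 - p.1)%:C * g (ang p.2) ord0 j + p.1%:C * p.2 ord0 j.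
  by rewrite mxE [X in X + _]mxE [X in _ + X]mxE.
under eq_fun do rewrite sE.
rewrite sE; exact: cvgD (cvgM c2 (c4 j)) (cvgM c1 (c3 j)).
Qed.

Let shrink (p : R * 'rV[CC R]_n) : 'rV[CC R]_n :=
  if p.1 < 1 then ang (average zz (1 - p.1, p.2)) else p.2.

Let shrink_Theta t th : 0 <= t <= 1 -> Theta th -> Theta (shrink (t, th)).
Proof.
move=> _ Tth; rewrite /shrink/=; case: ifPn => // t1.
by eexists; last reflexivity; apply: average_Z => //; rewrite subr_gt0.
Qed.

(** For [t < 1] continuity holds in the ambient space. At [t = 1] it holds only within the domain,
    through the estimate [ang_average_near], which concerns angles in [Theta]. *)
Let shrink_continuous :
  {within [set p | 0 <= p.1 <= 1 /\ Theta p.2], continuous shrink}.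
Proof.
apply/subspace_continuousP => -[t th] [/andP[t0 t1] Tth].
rewrite /= in t0 t1 Tth.
move: t1; rewrite le_eqVlt => /predU1P[{t0}->|t1]; last first.
  have c : {for (t, th), continuous (fun p : R * 'rV[CC R]_n =>
      ang (average zz (1 - p.1, p.2)))}.
    have s0 : 0 < 1 - t by rewrite subr_gt0.
    apply: (@continuous_comp _ _ _
      (fun p : R * 'rV[CC R]_n => average zz (1 - p.1, p.2))).
      apply: (@continuous_comp _ _ _
        (fun p : R * 'rV[CC R]_n => (1 - p.1, p.2)) (average zz)).
        apply: (@continuous_pair (R * 'rV[CC R]_n)%type R 'rV[CC R]_n
          (fun p => 1 - p.1) snd (t, th)); last exact: cvg_snd.
        by apply: cvgB; [exact: cvg_cst|exact: cvg_fst].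
      by apply: average_continuous => //=; exact: reached_Theta.
    by apply: ang_continuous; have [] := average_Z _ _ s0 Tth.
  have sE : shrink (t, th) = ang (average zz (1 - t, th)) by rewrite /shrink/= t1.
  have near_lt1 : \forall p \near nbhs (t, th), p.1 < 1.
    exact: (@cvg_fst _ _ (nbhs t) (nbhs th) _ _ (lt_nbhsl t1)).
  have cs : shrink @ nbhs (t, th) --> shrink (t, th).
    rewrite sE; apply: cvg_trans c; apply: near_eq_cvg.
    by apply: filterS near_lt1 => p p1; rewrite /shrink p1.
  exact: cvg_within_filter cs.
set D := [set _ | _].
have sE : shrink (1, th) = th by rewrite /shrink/= ltxx.
suff c1 : shrink @ within D (nbhs (1 : R, th)) --> th by rewrite -{2}sE in c1.
pose P := (R * 'rV[CC R]_n)%type.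
apply: (@cvg_rV _ _ (within D (nbhs (1 : R, th)))) => j.
have c2 : (fun p : P => p.2 ord0 j) @ within D (nbhs (1 : R, th)) --> th ord0 j.
  apply: cvg_within_filter.
  apply: (@continuous_comp _ _ _ snd (fun M : 'rV[CC R]_n => M ord0 j) (1 : R, th)).
    exact: cvg_snd.
  exact: coord_continuous.
(* The majorant is the bound of [ang_average_near] at scale [1 - p.1]. *)
have B0 : (fun p : P => (8 * n%:R) * (1 - p.1))
    @ within D (nbhs (1 : R, th)) --> (0 : R).
  rewrite [X in _ --> X](_ : 0 = (8 * n%:R) * (1 - 1)); last by rewrite subrr mulr0.
  have c0 : (fun p : P => (8 * n%:R) * (1 - p.1)) @ nbhs (1 : R, th) -->
      (8 * n%:R) * (1 - 1 : R).
    by apply: cvgMr; apply: cvgB; [exact: cvg_cst|exact: cvg_fst].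
  exact: cvg_within_filter c0.
suff c3 : (fun p : P => shrink p ord0 j - p.2 ord0 j) @ within D (nbhs (1 : R, th)) -->
    (0 : CC R).
  have c4 : (fun p : P => shrink p ord0 j - p.2 ord0 j + p.2 ord0 j)
      @ within D (nbhs (1 : R, th)) --> 0 + th ord0 j by exact: cvgD c3 c2.
  rewrite add0r in c4; apply: cvg_trans c4; apply: near_eq_cvg; apply: nearW => p.
  exact: subrK.
apply: cvg0_norm1_le B0.
have half_lt1 : 2^-1 < 1 :> R by rewrite invf_lt1// ltr1n.
(* This keeps the scale [1 - p.1] below [1/2], as [ang_average_near] demands. *)
have near_gt : \forall p \near nbhs (1 : R, th), 2^-1 < p.1.
  exact: (@cvg_fst _ _ (nbhs (1 : R)) (nbhs th) _ _ (lt_nbhsr half_lt1)).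
rewrite near_withinE; apply: filterS near_gt => p p2 [/andP[p0 p1] Tp].
rewrite mulrAC mulr_natr /shrink.
case: ifPn => pn1; last first.
  rewrite subrr /norm1/= normr0 addr0 mulrn_wge0// mulr_ge0// subr_ge0//.
have s0 : 0 < 1 - p.1 by rewrite subr_gt0.
apply: le_trans (norm1_le_dist1 _ _ _) _.
apply: (@ang_average_near _ _ _ _ (1 - p.1, p.2)) => //=.
- exact: reached_Theta.
- exact: Theta_circle.
- lra.
Qed.

Lemma ang_homotopy_equivalence : homotopy_equivalence R Z Theta (@ang R n).
Proof.
split.
- apply: continuous_in_subspaceT => x; rewrite inE => -[xT _].
  exact: ang_continuous.
- by move=> x Zx; exists x.
exists g; split.
- by apply: continuous_in_subspaceT => x; rewrite inE; exact: g_continuous.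
- by move=> th; exact: average_Z.
- exists segment; split.
  + apply: continuous_in_subspaceT => -[t x]; rewrite inE => -[_ Zx].
    exact: segment_continuous.
  + exact: segment_Z.
  + by move=> x _; rewrite /segment/= subr0 scale1r scale0r addr0.
  + by move=> x _; rewrite /segment/= subrr scale0r scale1r add0r.
- exists shrink; split; [exact: shrink_continuous|exact: shrink_Theta| |].
  + by move=> x _; rewrite /shrink/= ltr01 subr0.
  + by move=> x _; rewrite /shrink/= ltxx.
Qed.

End HomotopyEquivalence.

Theorem theoremA (R : realType) (n : nat) (Z : set 'rV[CC R]_n) :
  very_affine_linear Z ->
  ((@ang R n) @` Z `<=` @circle_torus R n) /\
  homotopy_equivalence R Z ((@ang R n) @` Z) (@ang R n).
Proof.
move=> [Z0 [m [A [b ZE]]]].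
(* Density is required of the angles and not of the points themselves, hence the choice of [ang] as
   the map. *)
have [zz zzZ zz_dense] := dense_sequence (@ang R n) _ Z0.
split.
  by move=> _ [z Zz <-]; apply: ang_circle; move: Zz; rewrite ZE => -[].
by subst Z; exact: ang_homotopy_equivalence zzZ zz_dense.
Qed.
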